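(* Let $H$ be a real Hilbert space, $C\subset H$ a nonempty closed convex set, and $A:H\to H$ an operator. Let $S$ be the set of $x^*\in C$ with $\langle Ax^*,x-x^*\rangle\ge 0$ for all $x\in C$, and let $S_D$ be the set of $x^*\in C$ with $\langle Az,z-x^*\rangle\ge 0$ for all $z\in C$. Assume: (i) $S_D\neq\emptyset$; (ii) $A$ is Lipschitz continuous on $H$; (iii) whenever $\{u_k\}\subset C$ and $u_k\rightharpoonup v^*$, one has $\|Av^*\|\le\liminf_{k\to\infty}\|Au_k\|$; (iv) $A$ is quasimonotone on $H$; (v) the set $\{v\in C: Av=0\}\setminus S_D$ is finite. Let $\mu\in(0,1)$ and let $\alpha,\beta\in\mathbb{R}$ satisfy: (a) $0\le\alpha\le\frac{1-\mu}{3+\mu}$; (b) $\max\left\{2\alpha\left(\frac{1-\mu}{3+\mu}\right)-(1-\alpha),\ \frac12\left[\alpha(1+\mu)-\frac{(1-\mu)(1-\alpha)^2}{1+\alpha}\right]\right\}<\beta\le 0$; (c) $2\alpha^2\mu-(1-3\alpha)+\mu(1-\alpha)-\beta(4\alpha+3-\mu)+2\mu\beta^2<0$. Assume moreover that $Ax\neq 0$ for all $x\in C$. Let $\{x_k\}$ be an infinite sequence generated by the two-step inertial Tseng algorithm (described in the context) with these $A,C,\mu,\alpha,\beta$. Then $\{x_k\}$ converges weakly to an element of $S_D$, and $S_D\subset S$.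
   Context: $P_C$ denotes the metric projection of $H$ onto $C$; $\rightharpoonup$ denotes weak convergence. $A$ is quasimonotone on $H$ if for all $x,y\in H$, $\langle Ax,y-x\rangle>0$ implies $\langle Ay,y-x\rangle\ge 0$. Two-step inertial Tseng algorithm. Parameters: $\gamma>0$, $l\in(0,1)$, $\mu\in(0,1)$, $\lambda_0>0$, $\alpha,\beta\in\mathbb{R}$, and arbitrary starting points $x_{-1},x_0,x_1\in H$. For each $k\ge1$, given $x_{k-2},x_{k-1},x_k$, the quantities $w_k,y_k,\lambda_k,x_{k+1}$ satisfy: $$w_k=x_k+\alpha(x_k-x_{k-1})+\beta(x_{k-1}-x_{k-2}),\qquad y_k=P_C(w_k-\lambda_kAw_k),$$ where $\lambda_k=\min\{\lambda_k^{(1)},\lambda_k^{(2)}\}$, $$\lambda_k^{(1)}=\begin{cases}\min\left\{\dfrac{\mu\|w_k-y_k\|}{\|Aw_k-Ay_k\|},\lambda_{k-1}\right\},& Aw_k-Ay_k\neq0,\\ \lambda_{k-1},&\text{otherwise,}\end{cases}$$ and $\lambda_k^{(2)}=\gamma l^{m_k}$ with $m_k$ the smallest nonnegative integer $m$ such that $\gamma l^{m}\|Aw_k-Ay_k\|\le\mu\|w_k-y_k\|$. If $y_k=w_k$ the algorithm stops; otherwise $$x_{k+1}=y_k-\lambda_k(Ay_k-Aw_k).$$ The relations for $w_k,y_k,\lambda_k$ are understood as holding simultaneously (the same $y_k$ appears in the definition of $\lambda_k$). An infinite sequence generated by the algorithm is one for which these relations hold for all $k\ge1$ and the stopping criterion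 is never met ($y_k\ne w_k$ for all $k$). *)

(* Defs.v *)
From mathcomp Require Export all_boot all_order all_algebra.
From mathcomp Require Export all_classical all_reals all_analysis.
Export numFieldNormedType.Exports.

Set Implicit Arguments.
Unset Strict Implicit.
Unset Printing Implicit Defensive.

Import Order.TTheory GRing.Theory Num.Theory.
Local Open Scope classical_set_scope.
Local Open Scope ring_scope.

(* A real Hilbert space is a complete normed module [H] with an inner product *)
(* [ip : {dot H for idfun}] (bilinear, symmetric, positive definite) that     *)
(* induces the norm; the latter is this predicate.                            *)
Definition induces_norm (R : realType) (H : completeNormedModType R)
    (ip : {dot H for idfun}) : Prop :=
  forall x : H, ip x x = `|x| ^+ 2.

Definition weak_cvg (R : realType) (H : completeNormedModType R)
    (ip : {dot H for idfun}) (u : nat -> H) (p : H) : Prop :=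
  forall v : H, (fun n => ip (u n) v) @ \oo --> ip p v.

Definition quasimonotone (R : realType) (H : completeNormedModType R)
    (ip : {dot H for idfun}) (A : H -> H) : Prop :=
  forall x y : H, 0 < ip (A x) (y - x) -> 0 <= ip (A y) (y - x).

Definition VI_solutions (R : realType) (H : completeNormedModType R)
    (ip : {dot H for idfun}) (A : H -> H) (C : set H) : set H :=
  [set p | C p /\ forall x, C x -> 0 <= ip (A p) (x - p)].

Definition dual_VI_solutions (R : realType) (H : completeNormedModType R)
    (ip : {dot H for idfun}) (A : H -> H) (C : set H) : set H :=
  [set p | C p /\ forall z, C z -> 0 <= ip (A z) (z - p)].

(* [p] = P_C(u); such a [p] exists and is unique for [C] nonempty, closed and *)
(* convex.                                                                    *)
Definition is_metric_projection (R : realType) (H : completeNormedModType R)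
    (C : set H) (u p : H) : Prop :=
  C p /\ forall z, C z -> `|u - p| <= `|u - z|.

Definition stepsize1 (R : realType) (H : completeNormedModType R)
    (A : H -> H) (mu : R) (w y : H) (lam_prev : R) : R :=
  if A w - A y != 0
  then Num.min (mu * `|w - y| / `|A w - A y|) lam_prev
  else lam_prev.

Definition linesearch_test (R : realType) (H : completeNormedModType R)
    (A : H -> H) (gamma l mu : R) (w y : H) (m : nat) : Prop :=
  gamma * l ^+ m * `|A w - A y| <= mu * `|w - y|.

Definition is_linesearch_index (R : realType) (H : completeNormedModType R)
    (A : H -> H) (gamma l mu : R) (w y : H) (m : nat) : Prop :=
  linesearch_test A gamma l mu w y m /\
  forall j : nat, linesearch_test A gamma l mu w y j -> (m <= j)%N.

(* The iterates are indexed from -1: [x n] is x_(n-1), so that x_(-1), x_0    *)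
(* and x_1 are [x 0], [x 1] and [x 2]. The indices of [w], [y], [lam] and [m] *)
(* are not shifted, and [w 0], [y 0], [m 0] are irrelevant.                   *)
Definition two_step_inertial_tseng (R : realType)
    (H : completeNormedModType R) (A : H -> H) (C : set H)
    (gamma l mu lambda0 alpha beta : R) (x : nat -> H) : Prop :=
  exists (w y : nat -> H) (lam : nat -> R) (m : nat -> nat),
    lam 0%N = lambda0 /\
    forall k : nat, (1 <= k)%N ->
      [/\ w k = x k.+1 + alpha *: (x k.+1 - x k) + beta *: (x k - x k.-1),
          is_metric_projection C (w k - lam k *: A (w k)) (y k),
          is_linesearch_index A gamma l mu (w k) (y k) (m k) /\
          lam k = Num.min (stepsize1 A mu (w k) (y k) (lam k.-1))
                          (gamma * l ^+ m k),
          y k <> w k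
        & x k.+2 = y k - lam k *: (A (y k) - A (w k))].

(* Main.v *)
(* For [p] in [S_D], one step of Tseng's method gives                         *)
(*   [(1 + mu) |x_(k+1) - p|^2 + (1 - mu) |x_(k+1) - w_k|^2                   *)
(*      <= (1 + mu) |w_k - p|^2].                                             *)
(* Expanding [w_k] shows that [|x_k - p|^2 - alpha |x_(k-1) - p|^2            *)
(* - beta |x_(k-2) - p|^2], corrected by multiples of [|x_k - x_(k-1)|^2] and *)
(* [|x_(k-1) - x_(k-2)|^2], decreases; since [alpha < 1] this bounds [x_k],   *)
(* and it yields [x_(k+1) - x_k --> 0] and the convergence of [|x_k - p|].    *)
(* By quasimonotonicity and the weak lower semicontinuity of [|A .|], every   *)
(* weak cluster point lies in [S_D], and Opial's argument concludes. Weak     *)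
(* sequential compactness of bounded sequences is obtained from the limit     *)
(* along an ultrafilter and the Riesz representation theorem, by extracting   *)
(* an almost orthogonal subsequence.                                          *)
Require Import Defs.
From mathcomp Require Import ring lra.

Set Implicit Arguments.
Unset Strict Implicit.
Unset Printing Implicit Defensive.

Import Order.TTheory GRing.Theory Num.Theory.
Local Open Scope classical_set_scope.
Local Open Scope ring_scope.

(** The inertia destroys the monotone decrease of [|x_k - p|], but not of a Lyapunov function.
    [tseng_step] combines the obtuse angle at the projection, the inequality defining [S_D] at
    [y_k], and the line search bound on [lam k * |A w_k - A y_k|]. [inertial_estimate] rewrites the
    result in terms of successive iterates, and condition (c) leaves a negative multiple of
    [|x_(k+1) - x_k|^2], which [inertial_fejer] telescopes.

    Then [x_k], [w_k] and [y_k] are asymptotically equal, and [stepsize_lower_bound] keeps the steps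
    away from 0. So the projection inequality, divided by [lam k], says that [y_k] solves the
    variational inequality up to an error tending to 0. Since [A] does not vanish on [C], [|A y_k|]
    stays away from 0 along a weakly convergent subsequence. A small shift of the test point then
    makes the inequality strict, and quasimonotonicity transfers it from [A y_k] to [A z]
    ([weak_limit_dual_VI]). [opial] turns this into weak convergence of the whole sequence. *)

Section Generalities.
Variable R : realType.

(** Extracts the first-order term of an inequality along a segment [p + t *: (z - p)] as [t] tends
    to 0. *)
Lemma le0_of_le_small (a b : R) :
  (forall t, 0 < t <= 1 -> a <= t * b) -> a <= 0.
Proof.
move=> h; rewrite leNgt; apply/negP => a_gt0.
have ab : a <= b by rewrite -[b]mul1r h // ltr01 lexx.
have b_gt0 : 0 < b by exact: lt_le_trans ab.
have := h (a / (2 * b)); rewrite divr_gt0 ?mulr_gt0 //= ler_pdivrMr ?mulr_gt0 //.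
have -> : a / (2 * b) * b = a / 2 by field; lra.
by move=> /(_ ltac:(lra)); lra.
Qed.

Lemma cvgn_dist_le (V : normedModType R) (u : nat -> V) (p : V) (e : nat -> R) :
  (\forall n \near \oo, `|u n - p| <= e n) -> e @ \oo --> (0 : R) ->
  u @ \oo --> p.
Proof.
move=> ue e0; apply/cvgrPdistC_lt => eps eps_gt0.
near=> n; apply: (@le_lt_trans _ _ (e n)); first by near: n.
apply: (@le_lt_trans _ _ `|e n|); first exact: ler_norm.
by near: n; exact: cvgr0_norm_lt.
Unshelve. all: by end_near. Qed.

Lemma strictly_increasing_ge (s : nat -> nat) :
  (forall n, (s n < s n.+1)%N) -> forall n, (n <= s n)%N.
Proof. by move=> sS; elim=> [//|n IH]; exact: leq_ltn_trans IH (sS n). Qed.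

Lemma cvgn_extract (s : nat -> nat) :
  (forall n, (s n < s n.+1)%N) -> s @ \oo --> \oo.
Proof.
move=> sS; apply/cvgnyPge => N; near=> n.
by apply: leq_trans (strictly_increasing_ge sS n); near: n; exact: nbhs_infty_ge.
Unshelve. all: by end_near. Qed.

End Generalities.

(** * Weak convergence in Hilbert spaces *)

Section Hilbert.
Variables (R : realType) (H : completeNormedModType R).
Variables (ip : {dot H for idfun}) (h_ip : induces_norm ip).

Lemma ipC u v : ip u v = ip v u.
Proof. by rewrite hermC expr0 mul1r. Qed.
Lemma ipDl u v w : ip (u + v) w = ip u w + ip v w.
Proof. exact: linearDl. Qed.
Lemma ipDr u v w : ip w (u + v) = ip w u + ip w v.
Proof. exact: linearDr. Qed.
Lemma ipZl a u w : ip (a *: u) w = a * ip u w.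
Proof. exact: linearZl_LR. Qed.
Lemma ipZr a u w : ip w (a *: u) = a * ip w u.
Proof. by rewrite ipC ipZl ipC. Qed.
Lemma ipNl u w : ip (- u) w = - ip u w.
Proof. by rewrite -scaleN1r ipZl mulN1r. Qed.
Lemma ipNr u w : ip w (- u) = - ip w u.
Proof. by rewrite -scaleN1r ipZr mulN1r. Qed.
Lemma ip0l u : ip 0 u = 0.
Proof. by rewrite -(scale0r 0) ipZl mul0r. Qed.
Lemma ip0r u : ip u 0 = 0.
Proof. by rewrite ipC ip0l. Qed.

Definition ipE := (ipDl, ipDr, ipNl, ipNr, ipZl, ipZr).

Lemma ip_cauchy_schwarz u v : `|ip u v| <= `|u| * `|v|.
Proof.
have [->|v0] := eqVneq v 0; first by rewrite ip0r normr0 normr0 mulr0.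
have v_gt0 : 0 < `|v| by rewrite normr_gt0.
rewrite -(@ler_pXn2r _ 2) ?nnegrE ?mulr_ge0 // exprMn -normrX ger0_norm ?sqr_ge0 //.
have : 0 <= ip (`|v| ^+ 2 *: u - ip u v *: v) (`|v| ^+ 2 *: u - ip u v *: v).
  by rewrite h_ip sqr_ge0.
rewrite !ipE (ipC v u) !h_ip => h.
have {}h : 0 <= `|v| ^+ 2 * (`|u| ^+ 2 * `|v| ^+ 2 - ip u v ^+ 2) by lra.
by move: h; rewrite pmulr_rge0 ?exprn_gt0 // subr_ge0.
Qed.

Lemma ip_le u v : ip u v <= `|u| * `|v|.
Proof. exact: le_trans (ler_norm _) (ip_cauchy_schwarz _ _). Qed.

Lemma ip_ge u v : - (`|u| * `|v|) <= ip u v.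
Proof. by have := ip_cauchy_schwarz u v; rewrite ler_norml => /andP[]. Qed.

Lemma convex_set_segment (C : set H) u v t :
  convex_set C -> C u -> C v -> 0 <= t <= 1 -> C (u + t *: (v - u)).
Proof.
move=> cvxC Cu Cv /andP[t0 t1].
have t01 : Itv.spec (@Itv.num_sem R) (Itv.Real `[0%Z, 1%Z]) t.
  by rewrite /Itv.spec /= /Itv.num_sem /= in_itv /= t0 t1 ger0_real.
have := cvxC v u (Itv.Def t01) (mem_set Cv) (mem_set Cu) => /set_mem /=.
rewrite /conv /= /unstable.onem.
by congr (C _); rewrite scalerBl scale1r scalerBr addrC -!addrA; congr (_ + _); rewrite addrC.
Qed.

(* With [C = setT] this is the Riesz representation theorem; with [f = ip u]  *)
(* it is the characterization of the projection of [u] on [C].                *)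
Lemma variational_minimum (C : set H) (f : H -> R) (K : R) :
  C !=set0 -> closed C -> convex_set C ->
  (forall u v, f (u + v) = f u + f v) -> (forall a u, f (a *: u) = a * f u) ->
  (forall u, `|f u| <= K * `|u|) ->
  exists2 p, C p & forall z, C z -> f (z - p) <= ip p (z - p).
Proof.
move=> C0 Cclosed Cconvex fD fZ fK.
have fN u : f (- u) = - f u by rewrite -scaleN1r fZ mulN1r.
(* If [f = ip q] then [J v = |v - q|^2 - |q|^2], so minimizing [J] is projecting [q]; this form
   makes sense before [f] is known to be represented. *)
pose J v : R := `|v| ^+ 2 - 2 * f v.
have JE u v t : J (u + t *: (v - u)) =
    J u + 2 * t * (ip u (v - u) - f (v - u)) + t ^+ 2 * `|v - u| ^+ 2.
  by rewrite /J -!h_ip fD fZ !ipE (ipC v u); ring.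
have J_lb : lbound (J @` C) (- K ^+ 2).
  move=> _ [v Cv <-]; rewrite /J.
  have := le_trans (ler_norm _) (fK v); have := sqr_ge0 (`|v| - K).
  by rewrite sqrrB; lra.
have J_inf : has_inf (J @` C).
  by split; [exact: image_nonempty | exists (- K ^+ 2)].
set m := inf (J @` C).
have m_le v : C v -> m <= J v by move=> Cv; apply: ge_inf; [exists (- K ^+ 2) | exists v].
have /choice[v hv] (n : nat) : exists v, C v /\ J v < m + harmonic n.
  have n_gt0 : 0 < harmonic n :> R by rewrite invr_gt0.
  by have [_ [v Cv <-] Jv] := inf_adherent n_gt0 J_inf; exists v.
(* Parallelogram law: [J] at the midpoint is the mean of [J (v n)] and [J (v k)] minus
   [|v n - v k|^2 / 4], and it is at least [m]. *)
have dist n k : `|v n - v k| ^+ 2 <= 2 * (harmonic n + harmonic k).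
  have [[Cn Jn] [Ck Jk]] := (hv n, hv k).
  have := m_le _ (convex_set_segment (t := 2^-1) Cconvex Ck Cn ltac:(lra)).
  have := JE (v k) (v n) 1; rewrite scale1r addrCA subrr addr0.
  by rewrite JE; lra.
have v_cvg : cvgn v.
  apply/cauchy_cvgP/cauchy_exP => e e_gt0.
  have e4 : 0 < e ^+ 2 / 4 by rewrite divr_gt0 ?exprn_gt0.
  have [N _ hN] := cvgr_lt _ (@cvg_harmonic R) _ e4.
  exists (v N); exists N => // n Nn; rewrite /= -ball_normE /=.
  rewrite -(@ltr_pXn2r _ 2) ?nnegrE ?(ltW e_gt0) //; apply: le_lt_trans (dist _ _) _.
  have : harmonic N < e ^+ 2 / 4 by exact: hN (leqnn N).
  have : harmonic n < e ^+ 2 / 4 by exact: hN Nn.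
  by lra.
pose p := limn v.
have Cp : C p by apply: (closed_cvg C Cclosed _ p v_cvg); near=> n; exact: (hv n).1.
have f_cvg : f (v n) @[n --> \oo] --> f p.
  apply: (@cvgn_dist_le _ R^o _ _ (fun n => K * `|v n - p|)).
    by near=> n; have := fK (v n - p); rewrite fD fN.
  rewrite -(mulr0 K); apply: cvgM; first exact: cvg_cst.
  by rewrite -(@normr0 _ H) -(subrr p); apply: cvg_norm; apply: cvgB => //; exact: cvg_cst.
have J_cvg : J (v n) @[n --> \oo] --> J p.
  apply: cvgB; last by apply: cvgM => //; exact: cvg_cst.
  by rewrite expr2; apply: cvgM; exact: cvg_norm.
have Jp : J p <= m.
  rewrite -[m]addr0; apply: (ler_cvg_to J_cvg (cvgD (cvg_cst m) (@cvg_harmonic R))).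
  by near=> n; rewrite ltW //; exact: (hv n).2.
exists p => // z Cz.
suff : 2 * (f (z - p) - ip p (z - p)) <= 0 by lra.
apply: (@le0_of_le_small _ _ (`|z - p| ^+ 2)) => t /andP[t_gt0 t1].
have := m_le _ (convex_set_segment (t := t) Cconvex Cp Cz ltac:(lra)).
rewrite JE => h.
have {}h : 0 <= t * (t * `|z - p| ^+ 2 - 2 * (f (z - p) - ip p (z - p))) by lra.
by move: h; rewrite pmulr_rge0 // subr_ge0.
Unshelve. all: by end_near. Qed.

Lemma riesz_representation (f : H -> R) (K : R) :
  (forall u v, f (u + v) = f u + f v) -> (forall a u, f (a *: u) = a * f u) ->
  (forall u, `|f u| <= K * `|u|) -> exists p, forall v, f v = ip p v.
Proof.
move=> fD fZ fK.
have [||p _ hp] := @variational_minimum setT f K _ closedT _ fD fZ fK.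
- by exists 0.
- by move=> x y t _ _; rewrite in_setT.
exists p => v; apply/eqP; rewrite eq_le; apply/andP; split.
  by have := hp (p + v) I; rewrite addrC addKr.
have := hp (p - v) I; rewrite addrC addKr ipNr -scaleN1r fZ; lra.
Qed.

(** Let [q] be the projection of [p] on [C]. The inequality [ip (p - q) (u n - q) <= 0] is affine in
    [u n], so it survives the weak limit and gives [|p - q|^2 <= 0]. *)
Lemma weak_cvg_closed_convex (C : set H) (u : nat -> H) p :
  closed C -> convex_set C -> (forall n, C (u n)) -> weak_cvg ip u p -> C p.
Proof.
move=> Cclosed Cconvex Cu up.
have [||q Cq hq] := @variational_minimum C (ip p) `|p| _ Cclosed Cconvex
  (fun u v => ipDr u v p) (fun a u => ipZr a u p).
- by exists (u 0%N).
- exact: ip_cauchy_schwarz.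
suff : ip p (p - q) <= ip q (p - q).
  move=> h; suff : `|p - q| ^+ 2 <= 0.
    by rewrite real_exprn_even_le0 //= normr_eq0 subr_eq0 => /eqP ->.
  by rewrite -h_ip ipDl ipNl; lra.
apply: (ler_cvg_to (up (p - q)) (cvg_cst _)); near=> n.
have := hq _ (Cu n); rewrite !ipE (ipC p (u n)) (ipC q (u n)) (ipC q p); lra.
Unshelve. all: by end_near. Qed.

Lemma weak_cvg_dist0 (u v : nat -> H) p :
  weak_cvg ip u p -> `|v n - u n| @[n --> \oo] --> (0 : R) -> weak_cvg ip v p.
Proof.
move=> up vu z.
have -> : (fun n => ip (v n) z) = (fun n => ip (u n) z + ip (v n - u n) z).
  by apply/funext => n; rewrite -ipDl addrCA subrr addr0.
rewrite -[ip p z]addr0; apply: cvgD; first exact: up.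
apply: (@cvgn_dist_le _ R^o _ _ (fun n => `|v n - u n| * `|z|)).
  by near=> n; rewrite subr0; exact: ip_cauchy_schwarz.
by rewrite -(mul0r `|z|); apply: cvgM => //; exact: cvg_cst.
Unshelve. all: by end_near. Qed.

Lemma ultrafilter_bounded_cvg (U : set_system nat) (g : nat -> R) (K : R) :
  UltraFilter U -> (forall n, `|g n| <= K) -> exists l : R, g @ U --> l.
Proof.
move=> UU gK.
have [|l [_ gl]] := @segment_compact R (- K) K (g @ U) _.
  by apply: (@filterS _ U _ setT) filterT => n _; rewrite /= in_itv /= -ler_norml.
exists l => A Al; have [//|UnA] := in_ultra_setVsetC (g @^-1` A) UU.
have [|_ [/= nA /nA //]] := gl (~` A) A _ Al.
exact: UnA.
Unshelve. all: by end_near. Qed.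

(* The sums [s_N = \sum_(n < N) a_n d_n], [a_n = ip (d_n) v], satisfy         *)
(* [ip s_N v = T_N] and [|s_N|^2 <= M^2 T_N + const], [T_N = \sum a_n^2].     *)
(* Cauchy-Schwarz then bounds [T_N], hence [a_n --> 0].                       *)
Lemma almost_orthogonal_weak_cvg0 (d : nat -> H) (M : R) :
  (forall n, `|d n| <= M) ->
  (forall i j, (i < j)%N -> `|ip (d j) (d i)| <= 2^-1 ^+ j * harmonic j) ->
  weak_cvg ip d 0.
Proof.
move=> dM dO v; rewrite ip0l.
pose a n : R := ip (d n) v; pose B := M * `|v|.
have M_ge0 : 0 <= M by exact: le_trans (dM 0%N).
have B_ge0 : 0 <= B by rewrite mulr_ge0.
have aB n : `|a n| <= B.
  by apply: le_trans (ip_cauchy_schwarz _ _) _; rewrite ler_wpM2r.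
pose s N : H := \sum_(n < N) a n *: d n.
pose T : nat -> R := series (fun n => a n ^+ 2).
have TS N : T N.+1 = T N + a N ^+ 2 by rewrite /T seriesSr.
have sS N : s N.+1 = s N + a N *: d N by rewrite /s big_ord_recr.
(* The factor [harmonic j] in the hypothesis absorbs the number [N] of terms when [j = N]. *)
have sO N j : (N <= j)%N -> `|ip (s N) (d j)| <= N%:R * (B * (2^-1 ^+ j * harmonic j)).
  elim: N => [|N IH] Nj; first by rewrite /s big_ord0 ip0l normr0 mul0r.
  rewrite sS ipDl ipZl -[N.+1%:R]natr1 mulrDl mul1r.
  apply: le_trans (ler_normD _ _) _; apply: lerD; first exact: IH (ltnW Nj).
  by rewrite normrM ler_pM // ipC dO.
have sOB N : `|ip (s N) (d N)| <= B * 2^-1 ^+ N.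
  apply: le_trans (sO N N (leqnn N)) _.
  rewrite mulrCA ler_wpM2l // mulrCA ler_piMr ?exprn_ge0 //.
  by rewrite /= ler_pdivrMr ?mul1r ?ler_nat.
(* The cross term at stage [N] is at most [2 * B ^+ 2 * 2^-1 ^+ N], which is exactly the increment
   of the last summand. *)
have sN N : `|s N| ^+ 2 <= M ^+ 2 * T N + 4 * B ^+ 2 * (1 - 2^-1 ^+ N).
  elim: N => [|N IH].
    by rewrite /s big_ord0 /T /series /= big_geq // normr0 expr0 subrr !mulr0 addr0 expr0n.
  rewrite sS -h_ip !ipE (ipC (d N)) !h_ip TS (exprS _ N).
  have h1 : a N * ip (s N) (d N) <= B ^+ 2 * 2^-1 ^+ N.
    apply: le_trans (ler_norm _) _; rewrite normrM expr2 -mulrA.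
    by rewrite ler_pM.
  have h2 : a N ^+ 2 * `|d N| ^+ 2 <= M ^+ 2 * a N ^+ 2.
    by rewrite mulrC ler_wpM2r ?sqr_ge0 // ler_pXn2r ?nnegrE.
  lra.
have sv N : ip (s N) v = T N.
  elim: N => [|N IH]; first by rewrite /s big_ord0 ip0l /T /series /= big_geq.
  by rewrite sS TS ipDl ipZl IH -expr2.
have T_ge0 N : 0 <= T N by rewrite /T /series /= sumr_ge0 // => i _; exact: sqr_ge0.
pose b := `|v| ^+ 2 * M ^+ 2; pose c := `|v| ^+ 2 * (4 * B ^+ 2).
have T_le N : T N <= b + c + 1.
  have b_ge0 : 0 <= b by rewrite mulr_ge0 ?sqr_ge0.
  have c_ge0 : 0 <= c by rewrite !mulr_ge0 ?sqr_ge0.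
  have h : T N ^+ 2 <= b * T N + c.
    rewrite -{1}sv -real_normK ?num_real //.
    apply: (@le_trans _ _ (`|s N| ^+ 2 * `|v| ^+ 2)).
      by rewrite -exprMn ler_pXn2r ?nnegrE ?mulr_ge0 //; exact: ip_cauchy_schwarz.
    have -> : b * T N + c = (M ^+ 2 * T N + 4 * B ^+ 2) * `|v| ^+ 2 by rewrite /b /c; ring.
    rewrite ler_wpM2r ?sqr_ge0 //.
    apply: le_trans (sN N) _; rewrite lerD2l.
    by rewrite mulrA ler_piMr ?mulr_ge0 ?sqr_ge0 // gerBl exprn_ge0.
  by rewrite leNgt; apply/negP => hlt; have := T_ge0 N; nra.
have T_cvg : cvgn T.
  apply: nondecreasing_is_cvgn.
    by apply/nondecreasing_seqP => n; rewrite TS lerDl sqr_ge0.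
  by exists (b + c + 1) => _ [n _ <-].
have := cvg_series_cvg_0 T_cvg => a0.
apply/cvgr0Pnorm_lt => e e_gt0; have e2_gt0 : 0 < e ^+ 2 by rewrite exprn_gt0.
near=> n; rewrite -(@ltr_pXn2r _ 2) ?nnegrE ?(ltW e_gt0) //.
rewrite -normrX; near: n; exact: cvgr0_norm_lt.
Unshelve. all: by end_near. Qed.

Lemma bounded_weak_subsequence (x : nat -> H) (M : R) :
  (forall n, `|x n| <= M) ->
  exists s p, (forall n, (s n < s n.+1)%N) /\ weak_cvg ip (x \o s) p.
Proof.
move=> xM.
have [U [UU tailU]] := ultraFilterLemma eventually_filter.
have UF : ProperFilter U by exact: ultra_proper.
have /choice[f f_lim] (v : H) : exists l : R, ip (x n) v @[n --> U] --> l.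
  apply: (ultrafilter_bounded_cvg (K := M * `|v|)) => n.
  by apply: le_trans (ip_cauchy_schwarz _ _) _; rewrite ler_wpM2r.
have [||| p fp] := @riesz_representation f M.
- move=> u v; apply: (cvg_unique _ (f_lim _)).
    exact: (@norm_hausdorff _ R^o).
  have -> : (fun n => ip (x n) (u + v)) = (fun n => ip (x n) u + ip (x n) v).
    by apply/funext => n; rewrite ipDr.
  exact: cvgD.
- move=> a u; apply: (cvg_unique _ (f_lim _)).
    exact: (@norm_hausdorff _ R^o).
  have -> : (fun n => ip (x n) (a *: u)) = (fun n => a * ip (x n) u).
    by apply/funext => n; rewrite ipZr.
  by apply: cvgM => //; exact: cvg_cst.
- move=> u; apply: (ler_cvg_to (cvg_norm (f_lim u)) (cvg_cst _)).
  near=> n; apply: le_trans (ip_cauchy_schwarz _ _) _; by rewrite ler_wpM2r.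
pose d n := x n - p.
have d_lim v : ip (d n) v @[n --> U] --> (0 : R).
  have -> : (fun n => ip (d n) v) = (fun n => ip (x n) v - ip p v).
    by apply/funext => n; rewrite ipDl ipNl.
  by rewrite -fp -(subrr (f v)); apply: cvgB => //; exact: cvg_cst.
(* Near orthogonality is required against every earlier index, not only the selected ones, so that
   [g] does not depend on previous choices. *)
have /choice[g g_lt] (N : nat) : exists n, (N <= n)%N /\
    forall i, (i < N)%N -> `|ip (d n) (d i)| <= 2^-1 ^+ N * harmonic N.
  have e_gt0 : 0 < 2^-1 ^+ N * harmonic N :> R by rewrite mulr_gt0 ?exprn_gt0 ?invr_gt0.
  have U_lt K : \forall n \near U,
      forall i, (i < K)%N -> `|ip (d n) (d i)| <= 2^-1 ^+ N * harmonic N.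
    elim: K => [|K IH]; first by near=> n.
    near=> n => i; rewrite ltnS leq_eqVlt => /orP[/eqP ->|iK].
      by rewrite ltW //; near: n; exact: cvgr0_norm_lt.
    by move: i iK; near: n.
  have UN : U [set n | (N <= n)%N] by apply: tailU; exact: nbhs_infty_ge.
  by have [n [Nn hn]] := filter_ex (filterI UN (U_lt N)); exists n.
pose s := fix s j := if j is j'.+1 then g (s j').+1 else g 0%N.
have sS j : (s j < s j.+1)%N by exact: (g_lt (s j).+1).1.
have s_mono := homo_leq leqnn leq_trans (fun j => ltnW (sS j)).
exists s, p; split=> // v.
have -> : (fun n => ip ((x \o s) n) v) = (fun n => ip ((d \o s) n) v + ip p v).
  by apply/funext => n; rewrite -ipDl subrK.
suff d0 : ip ((d \o s) n) v @[n --> \oo] --> ip 0 v.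
  by rewrite -[X in _ --> X]add0r -(ip0l v); apply: cvgD d0 (cvg_cst _).
apply: (@almost_orthogonal_weak_cvg0 (d \o s) (M + `|p|)) => [n|i [//|j] ij].
  by apply: le_trans (ler_normB _ _) _; rewrite lerD2r.
have sij : (s i < (s j).+1)%N by rewrite ltnS; exact: s_mono.
apply: le_trans ((g_lt (s j).+1).2 _ sij) _.
(* The bound available at index [(s j).+1] is smaller than the one wanted at [j.+1]. *)
have js : (j.+1 <= (s j).+1)%N by rewrite ltnS strictly_increasing_ge.
apply: ler_pM; rewrite ?exprn_ge0 ?invr_ge0 //.
  by rewrite ler_wiXn2l //; lra.
by rewrite /= lef_pV2 ?posrE // ler_nat ltnS.
Unshelve. all: by end_near. Qed.

End Hilbert.

(** * One step of Tseng's method *)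

Section TsengStep.
Variables (R : realType) (H : completeNormedModType R).
Variables (ip : {dot H for idfun}) (h_ip : induces_norm ip).

Lemma lipschitz_norm (A : H -> H) :
  lipschitz A -> exists2 L : R, 0 < L & forall u v, `|A u - A v| <= L * `|u - v|.
Proof.
(* [lipschitz] supplies only constants strictly beyond some [M]; the maximum with 1 makes the
   constant positive. *)
move=> [M [_ AM]]; exists (Num.max 1 (M + 1)); first by rewrite lt_max ltr01.
by move=> u v; apply: (AM _ _ (u, v)) => //; rewrite lt_max ltrDl ltr01 orbT.
Qed.

(** Minty's argument: test the dual inequality at [p + t *: (x - p)], divide by [t], and let [t]
    tend to 0 using the continuity of [A]. *)
Lemma dual_VI_subset (C : set H) (A : H -> H) (L : R) :
  convex_set C -> (forall u v, `|A u - A v| <= L * `|u - v|) ->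
  dual_VI_solutions ip A C `<=` VI_solutions ip A C.
Proof.
move=> Cconvex AL p [Cp hp]; split=> // x Cx; rewrite -oppr_le0.
apply: (@le0_of_le_small _ _ (L * `|x - p| ^+ 2)) => t /andP[t_gt0 t1].
set z := p + t *: (x - p).
have Cz : C z by apply: convex_set_segment; rewrite // ltW.
have zp : z - p = t *: (x - p) by rewrite /z addrC addKr.
have : 0 <= ip (A z) (x - p) by have := hp z Cz; rewrite zp ipZr pmulr_rge0.
have := ip_le h_ip (A z - A p) (x - p); rewrite ipDl ipNl.
have := ler_wpM2r (normr_ge0 (x - p)) (AL z p).
rewrite zp normrZ (gtr0_norm t_gt0); lra.
Qed.

Lemma metric_projection_obtuse (C : set H) (u p z : H) :
  convex_set C -> is_metric_projection C u p -> C z -> ip (u - p) (z - p) <= 0.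
Proof.
move=> Cconvex [Cp hp] Cz; suff : 2 * ip (u - p) (z - p) <= 0 by lra.
apply: (@le0_of_le_small _ _ (`|z - p| ^+ 2)) => t /andP[t_gt0 t1].
have := hp _ (@convex_set_segment _ _ _ p z t Cconvex Cp Cz ltac:(lra)).
rewrite -(@ler_pXn2r _ 2) ?nnegrE // opprD addrA -!h_ip.
rewrite (ipDl _ (u - p)) !(ipDr _ (u - p)) !ipNl !ipNr !ipZl !ipZr (ipC _ (z - p)) => h.
have {}h : 0 <= t * (t * ip (z - p) (z - p) - 2 * ip (u - p) (z - p)) by lra.
by move: h; rewrite pmulr_rge0 // subr_ge0.
Qed.

Lemma tseng_step (C : set H) (A : H -> H) (mu lam : R) (w y p x : H) :
  convex_set C -> 0 < mu < 1 -> 0 <= lam ->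
  lam * `|A w - A y| <= mu * `|w - y| ->
  is_metric_projection C (w - lam *: A w) y ->
  dual_VI_solutions ip A C p -> x = y - lam *: (A y - A w) ->
  (1 + mu) * `|x - p| ^+ 2 + (1 - mu) * `|x - w| ^+ 2 <= (1 + mu) * `|w - p| ^+ 2.
Proof.
move=> Cconvex /andP[mu_gt0 mu_lt1] lam_ge0 hlam proj_y [Cp hp] xE.
have Cy := proj_y.1.
have obt := metric_projection_obtuse Cconvex proj_y Cp.
have dual : 0 <= lam * ip (A y) (y - p) by rewrite mulr_ge0 // hp.
have hlam2 : (lam * `|A w - A y|) ^+ 2 <= mu ^+ 2 * `|w - y| ^+ 2.
  by rewrite -exprMn ler_pXn2r ?nnegrE ?mulr_ge0 // ltW.
(* Exactly, [|x - p|^2] is [|w - p|^2 - |w - y|^2 + lam^2 |A w - A y|^2] minus twice the two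
   nonnegative quantities of [obt] and [dual]. *)
have xp : `|x - p| ^+ 2 <= `|w - p| ^+ 2 - (1 - mu ^+ 2) * `|w - y| ^+ 2.
  move: obt dual hlam2; rewrite xE exprMn -!h_ip !ipE.
  rewrite ?(ipC ip p) ?(ipC ip (A y) y) ?(ipC ip (A w) y) ?(ipC ip (A w) (A y)).
  by rewrite ?(ipC ip w y) ?(ipC ip (A y) w) ?(ipC ip (A w) w); lra.
have xw : `|x - w| <= (1 + mu) * `|w - y|.
  have -> : x - w = (y - w) - lam *: (A y - A w) by rewrite xE addrAC.
  apply: le_trans (ler_normB _ _) _.
  by rewrite normrZ (ger0_norm lam_ge0) (distrC y) (distrC (A y)); lra.
have xw2 : `|x - w| ^+ 2 <= (1 + mu) ^+ 2 * `|w - y| ^+ 2.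
  by rewrite -exprMn ler_pXn2r ?nnegrE ?mulr_ge0 //; lra.
nra.
Qed.

Lemma stepsize_control (A : H -> H) (gamma l mu lam_prev : R) (w y : H) m :
  is_linesearch_index A gamma l mu w y m ->
  Num.min (stepsize1 A mu w y lam_prev) (gamma * l ^+ m) * `|A w - A y| <= mu * `|w - y|.
Proof.
by move=> [test _]; apply: le_trans test; rewrite ler_wpM2r // ge_min lexx orbT.
Qed.

(** The quotient in [stepsize1] is at least [mu / L]. If the line search stops at [m.+1], its test
    fails at [m], which forces [gamma * l ^+ m > mu / L]; one more factor [l] gives the bound
    [l * mu / L]. *)
Lemma stepsize_lower_bound (A : H -> H) (gamma l mu lam_prev L c : R) (w y : H) m :
  0 < gamma -> 0 < l < 1 -> 0 < mu ->
  (forall u v, `|A u - A v| <= L * `|u - v|) ->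
  0 < L -> c <= lam_prev -> c <= gamma -> c * L <= l * mu ->
  is_linesearch_index A gamma l mu w y m ->
  c <= Num.min (stepsize1 A mu w y lam_prev) (gamma * l ^+ m).
Proof.
move=> gamma_gt0 /andP[l_gt0 l_lt1] mu_gt0 AL L_gt0 c_prev c_gamma cL [test test_min].
have AwyL := AL w y.
rewrite le_min; apply/andP; split.
  rewrite /stepsize1; case: ifP => // Awy; rewrite le_min c_prev andbT.
  have Awy_gt0 : 0 < `|A w - A y| by rewrite normr_gt0.
  have [c_le0|c_gt0] := leP c 0.
    by apply: le_trans c_le0 _; rewrite divr_ge0 ?mulr_ge0 // ltW.
  rewrite ler_pdivlMr //; apply: (@le_trans _ _ (c * L * `|w - y|)).
    by rewrite -mulrA ler_pM2l.
  by rewrite ler_wpM2r //; apply: le_trans cL _; rewrite ler_piMl ?ltW.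
case: m test test_min => [|m] _ test_min; first by rewrite expr0 mulr1.
have : ~ linesearch_test A gamma l mu w y m by move/test_min; rewrite ltnn.
move/negP; rewrite -ltNge => fails.
have glm_gt0 : 0 < gamma * l ^+ m by rewrite mulr_gt0 ?exprn_gt0.
have : mu * `|w - y| < gamma * l ^+ m * L * `|w - y|.
  by apply: lt_le_trans fails _; rewrite -[leRHS]mulrA ler_pM2l.
have wy_gt0 : 0 < `|w - y|.
  rewrite lt_neqAle normr_ge0 andbT eq_sym; apply/eqP => wy0.
  by move: fails AwyL; rewrite wy0 !mulr0 => h1 h2; have : 0 <= `|A w - A y| by []; nra.
rewrite ltr_pM2r // => h.
rewrite -(@ler_pM2r _ L) //; apply: le_trans cL _.
by rewrite exprS mulrCA -mulrA ler_pM2l // ltW //.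
Qed.

End TsengStep.

(** * The inertial Lyapunov function *)

Section Inertial.
Variables (R : realType) (H : completeNormedModType R).
Variables (ip : {dot H for idfun}) (h_ip : induces_norm ip).

(** [w] is an affine combination of [x2], [x1], [x0] with coefficients [1 + alpha], [beta - alpha],
    [- beta]. So [|w - p|^2] is the same combination of the [|xi - p|^2], minus the products of two
    coefficients times the squared mutual distances. *)
Lemma inertial_estimate (mu alpha beta : R) (x3 x2 x1 x0 p w : H) :
  0 < mu -> mu < 1 -> 0 <= alpha -> beta <= 0 ->
  w = x2 + alpha *: (x2 - x1) + beta *: (x1 - x0) ->
  (1 + mu) * `|x3 - p| ^+ 2 + (1 - mu) * `|x3 - w| ^+ 2 <= (1 + mu) * `|w - p| ^+ 2 ->
  (1 + mu) * (`|x3 - p| ^+ 2 - alpha * `|x2 - p| ^+ 2 - beta * `|x1 - p| ^+ 2)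
    + (1 - mu) * (1 - alpha + beta) * `|x3 - x2| ^+ 2
  <= (1 + mu) * (`|x2 - p| ^+ 2 - alpha * `|x1 - p| ^+ 2 - beta * `|x0 - p| ^+ 2)
    + ((1 + mu) * (1 + alpha) * (alpha - beta)
       + (1 - mu) * alpha * (1 - alpha - beta)) * `|x2 - x1| ^+ 2
    - beta * ((1 + mu) * (alpha - beta) + (1 - mu) * (1 + alpha + beta))
      * `|x1 - x0| ^+ 2.
Proof.
move=> mu_gt0 mu_lt1 alpha_ge0 beta_le0 ->.
have subp u v : u - v = (u - p) - (v - p) by rewrite opprB addrA subrK.
have -> : x2 + alpha *: (x2 - x1) + beta *: (x1 - x0) - p =
    (x2 - p) + alpha *: ((x2 - p) - (x1 - p)) + beta *: ((x1 - p) - (x0 - p)).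
  by rewrite -!subp addrAC (addrAC x2).
have -> : x3 - (x2 + alpha *: (x2 - x1) + beta *: (x1 - x0)) =
    ((x3 - p) - (x2 - p)) - alpha *: ((x2 - p) - (x1 - p))
    - beta *: ((x1 - p) - (x0 - p)).
  by rewrite -!subp -addrA opprD addrA opprD addrA.
rewrite (subp x3 x2) (subp x2 x1) (subp x1 x0).
move: (x3 - p) (x2 - p) (x1 - p) (x0 - p) => d a b c {subp}.
have [nbeta_ge0 mu1_ge0 mu1'_ge0 alpha1_ge0] :
  [/\ 0 <= - beta, 0 <= 1 - mu, 0 <= 1 + mu & 0 <= 1 + alpha] by split; lra.
pose Q u := ip u u; have Q_ge0 u : 0 <= Q u by rewrite /Q h_ip sqr_ge0.
(* [h1], [h2], [h3] bound the cross terms of [`|x3 - w| ^+ 2] by Young's      *)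
(* inequality; [h4] drops the [`|x2 - x0| ^+ 2] term of [`|w - p| ^+ 2].      *)
have h1 : 0 <= (1 - mu) * alpha * Q ((d - a) - (a - b)) by rewrite !mulr_ge0.
have h2 : 0 <= (1 - mu) * - beta * Q ((d - a) + (b - c)) by rewrite !mulr_ge0.
have h3 : 0 <= (1 - mu) * (alpha * - beta) * Q ((a - b) - (b - c)) by rewrite !mulr_ge0.
have h4 : 0 <= (1 + mu) * (- beta * (1 + alpha)) * Q (a - c) by rewrite !mulr_ge0.
move: h1 h2 h3 h4; rewrite {Q_ge0} -!h_ip /Q !ipE.
rewrite ?(ipC ip d) ?(ipC ip c a) ?(ipC ip c b) ?(ipC ip b a).
lra.
Qed.

Lemma inertial_fejer (mu alpha beta : R) (x w : nat -> H) (p : H) :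
  0 < mu -> mu < 1 -> 0 <= alpha -> alpha - 1 < beta -> beta <= 0 ->
  2 * alpha ^+ 2 * mu - (1 - 3 * alpha) + mu * (1 - alpha)
    - beta * (4 * alpha + 3 - mu) + 2 * mu * beta ^+ 2 < 0 ->
  (forall n, w n = x n.+2 + alpha *: (x n.+2 - x n.+1) + beta *: (x n.+1 - x n)) ->
  (forall n, (1 + mu) * `|x n.+3 - p| ^+ 2 + (1 - mu) * `|x n.+3 - w n| ^+ 2
             <= (1 + mu) * `|w n - p| ^+ 2) ->
  [/\ exists M, forall n, `|x n| <= M,
      `|x n.+1 - x n| @[n --> \oo] --> (0 : R)
    & cvgn (fun n => `|x n - p| ^+ 2)].
Proof.
move=> mu_gt0 mu_lt1 alpha_ge0 beta_gt beta_le0 h_c wE step.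
pose N n : R := `|x n - p| ^+ 2; pose D n : R := `|x n.+1 - x n| ^+ 2.
have N_ge0 n : 0 <= N n by exact: sqr_ge0.
have D_ge0 n : 0 <= D n by exact: sqr_ge0.
pose a1 : R := (1 + mu) * (1 + alpha) * (alpha - beta) + (1 - mu) * alpha * (1 - alpha - beta).
pose a0 : R := - beta * ((1 + mu) * (alpha - beta) + (1 - mu) * (1 + alpha + beta)).
pose V n : R := N n.+2 - alpha * N n.+1 - beta * N n.
(* The weights on [D] make the terms [a1 * D n.+1 + a0 * D n] of [inertial_estimate] telescope, with
   [delta * D n.+2] left over. *)
pose G n : R := (1 + mu) * V n + (a1 + a0) * D n.+1 + a0 * D n.
pose delta : R := (1 - mu) * (1 - alpha + beta) - a1 - a0.
have a1_ge0 : 0 <= a1 by rewrite addr_ge0 ?mulr_ge0 //; lra.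
have a0_ge0 : 0 <= a0 by rewrite mulr_ge0 ?addr_ge0 ?mulr_ge0 //; lra.
(* [- delta] is the left-hand side of (c). *)
have delta_gt0 : 0 < delta by rewrite /delta /a1 /a0; lra.
have G_dec n : G n.+1 <= G n - delta * D n.+2.
  have := inertial_estimate mu_gt0 mu_lt1 alpha_ge0 beta_le0 (wE n) (step n).
  rewrite /G /V /delta /a1 /a0 /N /D; lra.
have G_noninc : nonincreasing_seq G.
  by apply/nonincreasing_seqP => n; apply: le_trans (G_dec n) _; rewrite gerBl mulr_ge0 // ltW.
have GV n : (1 + mu) * (N n.+2 - alpha * N n.+1) <= G n.
  have : 0 <= (1 + mu) * (- beta * N n) by rewrite !mulr_ge0 //; lra.
  have : 0 <= (a1 + a0) * D n.+1 by rewrite mulr_ge0 // addr_ge0.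
  have : 0 <= a0 * D n by rewrite mulr_ge0.
  by rewrite /G /V; lra.
(* The recursion [N n.+2 <= alpha * N n.+1 + |G 0|] is a contraction with fixed point
   [|G 0| / (1 - alpha)]. *)
pose K : R := N 1%N + `|G 0%N| / (1 - alpha).
have K_ge0 : 0 <= K by rewrite addr_ge0 // divr_ge0 //; lra.
have NK n : N n.+1 <= K.
  elim: n => [|n IH]; first by rewrite lerDl divr_ge0 //; lra.
  have Gn : (1 + mu) * (N n.+2 - alpha * N n.+1) <= `|G 0%N|.
    by apply: le_trans (GV n) (le_trans (G_noninc _ _ (leq0n n)) (ler_norm _)).
  have h1 : N n.+2 - alpha * N n.+1 <= `|G 0%N|.
    have [h|h] := leP (N n.+2 - alpha * N n.+1) 0; first exact: le_trans h _.
    by apply: le_trans Gn; rewrite ler_peMl ?(ltW h) //; lra.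
  have h2 : `|G 0%N| = (1 - alpha) * (K - N 1%N).
    by rewrite /K addrAC subrr add0r mulrC divfK //; lra.
  have : alpha * N n.+1 <= alpha * K by rewrite ler_wpM2l.
  have : 0 <= (1 - alpha) * N 1%N by rewrite mulr_ge0 //; lra.
  by lra.
have G_cvg : cvgn G.
  apply: nonincreasing_is_cvgn => //; exists (- ((1 + mu) * (alpha * K))) => _ [n _ <-].
  apply: le_trans (GV n); rewrite -mulrN ler_pM2l; last by lra.
  have : alpha * N n.+1 <= alpha * K by rewrite ler_wpM2l.
  by have := N_ge0 n.+2; lra.
have D_cvg0 : D n @[n --> \oo] --> (0 : R).
  rewrite -(cvg_shiftn 2) /=.
  have GG : delta^-1 * (G n - G n.+1) @[n --> \oo] --> (0 : R).
    rewrite -(mulr0 delta^-1) -(subrr (limn G)); apply: cvgM; first exact: cvg_cst.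
    by apply: cvgB => //; rewrite cvg_shiftS.
  apply: (@cvgn_dist_le _ R^o _ _ _ _ GG); near=> n.
  rewrite subr0 ger0_norm // addn2 -(@ler_pM2l _ delta) // mulVKf ?lt0r_neq0 //.
  by have := G_dec n; lra.
have x_diff : `|x n.+1 - x n| @[n --> \oo] --> (0 : R).
  apply/cvgr0Pnorm_lt => e e_gt0; have e2_gt0 : 0 < e ^+ 2 by rewrite exprn_gt0.
  near=> n; rewrite normr_id -(@ltr_pXn2r _ 2) ?nnegrE ?(ltW e_gt0) //.
  rewrite -[ltLHS]ger0_norm //; near: n; exact: cvgr0_norm_lt.
pose r := Num.max `|x 0%N - p| (K + 1).
have xr n : `|x n - p| <= r.
  rewrite le_max; case: n => [|n]; first by rewrite lexx.
  apply/orP; right; rewrite -(@ler_pXn2r _ 2) ?nnegrE //; last by lra.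
  by apply: le_trans (NK n) _; have := K_ge0; nra.
split=> //.
  exists (r + `|p|) => n; rewrite -[x n](subrK p).
  by apply: le_trans (ler_normD _ _) _; rewrite lerD2r.
have N_diff : N n.+1 - N n @[n --> \oo] --> (0 : R).
  apply: (@cvgn_dist_le _ R^o _ _ (fun n => `|x n.+1 - x n| * (2 * r))).
    near=> n; rewrite subr0 subr_sqr normrM ler_pM //.
      apply: le_trans (ler_dist_dist _ _) _.
      by rewrite opprB addrA subrK.
    apply: le_trans (ler_normD _ _) _; rewrite !normr_id.
    by have := xr n; have := xr n.+1; lra.
  by rewrite -(mul0r (2 * r)); apply: cvgM => //; exact: cvg_cst.
suff /cvg_ex[l Nl] : cvgn (fun n => N (n + 2)%N).
  by apply/cvg_ex; exists l; rewrite -(cvg_shiftn 2).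
(* [V n] differs from [(1 - alpha - beta) * N n.+2] only by differences of successive [N], which
   vanish in the limit. *)
have -> : (fun n => N (n + 2)%N) = (fun n => (1 - alpha - beta)^-1 *
   ((1 + mu)^-1 * (G n - (a1 + a0) * D n.+1 - a0 * D n)
    - (alpha + beta) * (N n.+2 - N n.+1) - beta * (N n.+1 - N n))).
  apply/funext => n; rewrite addn2 /G /V; field.
  by rewrite !lt0r_neq0 //; lra.
have shift0 (u : nat -> R) : u @ \oo --> (0 : R) -> u n.+1 @[n --> \oo] --> (0 : R).
  by rewrite (cvg_shiftS u).
apply: is_cvgM; first exact: is_cvg_cst.
apply: is_cvgB; last first.
  apply: is_cvgM; first exact: is_cvg_cst.
  by apply/cvg_ex; exists 0.
apply: is_cvgB; last first.
  apply: is_cvgM; first exact: is_cvg_cst.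
  by apply/cvg_ex; exists 0; exact: (shift0 (fun n => N n.+1 - N n)).
apply: is_cvgM; first exact: is_cvg_cst.
apply: is_cvgB; last first.
  by apply: is_cvgM; [exact: is_cvg_cst|apply/cvg_ex; exists 0].
apply: is_cvgB => //.
by apply: is_cvgM; [exact: is_cvg_cst|apply/cvg_ex; exists 0; exact: shift0].
Unshelve. all: by end_near. Qed.

End Inertial.

(** * Weak cluster points *)

Section WeakLimits.
Variables (R : realType) (H : completeNormedModType R).
Variables (ip : {dot H for idfun}) (h_ip : induces_norm ip).

Lemma limn_einf_ge_near (u : nat -> \bar R) (a : R) :
  (a%:E < limn_einf u)%E -> \forall n \near \oo, (a%:E <= u n)%E.
Proof.
rewrite limn_einf_lim => /(lte_lim (@nondecreasing_einfs _ u) (@is_cvg_einfs _ u)).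
by apply: filterS => n /le_trans; apply; apply: ereal_inf_lbound; exists n => //=.
Qed.

(* As [A (y k) != 0] stays away from [0], moving [z] by a multiple [q k] of   *)
(* [A (y k)] that tends to [0] makes [ip (A (y k)) (z + q k - y k)] positive, *)
(* and quasimonotonicity applies. *)
Lemma weak_limit_dual_VI (C : set H) (A : H -> H) (L M c0 mu : R)
    (w y : nat -> H) (lam : nat -> R) (v : H) :
  closed C -> convex_set C -> 0 < L ->
  (forall a b, `|A a - A b| <= L * `|a - b|) ->
  quasimonotone ip A -> (forall x, C x -> A x <> 0) ->
  ((`|A v|)%:E <= limn_einf (fun k => (`|A (y k)|)%:E))%E ->
  0 < mu < 1 -> 0 < c0 -> (forall k, c0 <= lam k) ->
  (forall k, lam k * `|A (w k) - A (y k)| <= mu * `|w k - y k|) ->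
  (forall k, is_metric_projection C (w k - lam k *: A (w k)) (y k)) ->
  (forall k, `|y k| <= M) -> `|w k - y k| @[k --> \oo] --> (0 : R) ->
  weak_cvg ip y v -> dual_VI_solutions ip A C v.
Proof.
move=> Cclosed Cconvex L_gt0 AL Aqm A0 Alsc /andP[mu_gt0 mu_lt1] c0_gt0 lam_ge.
move=> hlam proj_y yM wy0 yv.
have Cy k : C (y k) := (proj_y k).1.
have Cv : C v by exact: weak_cvg_closed_convex yv.
split=> // z Cz.
have M_ge0 : 0 <= M by exact: le_trans (yM 0%N).
pose B := M + `|z|; have B_ge0 : 0 <= B by rewrite addr_ge0.
have zyB k : `|z - y k| <= B.
  by apply: le_trans (ler_normB _ _) _; rewrite addrC lerD2r.
(* The first term is the possible deficit of [ip (A (y k)) (z - y k)] found in [Ay_ge]; [harmonic k]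
   makes the corrected product strictly positive. *)
pose e k : R := (1 + mu) / c0 * B * `|w k - y k| + harmonic k.
have e_gt0 k : 0 < e k.
  by rewrite ltr_wpDl ?invr_gt0 // !mulr_ge0 ?invr_ge0 ?(ltW c0_gt0) //; lra.
have e_cvg : e k @[k --> \oo] --> (0 : R).
  rewrite -[0]addr0; apply: cvgD; last exact: cvg_harmonic.
  by rewrite -(mulr0 ((1 + mu) / c0 * B)); apply: cvgM => //; exact: cvg_cst.
have Ay_ge k : - ((1 + mu) * (B * `|w k - y k|)) / c0 <= ip (A (y k)) (z - y k).
  have c1 : lam k * ip (A (y k)) (z - y k) >= - ((1 + mu) * (B * `|w k - y k|)).
    have := metric_projection_obtuse h_ip Cconvex (proj_y k) Cz.
    have := ip_ge h_ip (w k - y k) (z - y k).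
    have := ip_le h_ip (A (w k) - A (y k)) (z - y k).
    have h1 : `|w k - y k| * `|z - y k| <= `|w k - y k| * B by rewrite ler_wpM2l.
    have h2 : lam k * (`|A (w k) - A (y k)| * `|z - y k|) <= mu * `|w k - y k| * B.
      by rewrite mulrA ler_pM // mulr_ge0 // (le_trans (ltW c0_gt0)).
    have lam_ge0 : 0 <= lam k by exact: le_trans (ltW c0_gt0) _.
    move=> h3 h4; have := ler_wpM2l lam_ge0 h3.
    move: h4; rewrite addrAC !(ipDl _ _ _ (z - y k)) !(ipNl, ipZl); lra.
  have [X_ge0|X_lt0] := leP 0 (ip (A (y k)) (z - y k)).
    apply: le_trans X_ge0; rewrite mulNr oppr_le0 !mulr_ge0 ?invr_ge0 ?(ltW c0_gt0) //.
    by lra.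
  rewrite ler_pdivrMr // [leRHS]mulrC; apply: le_trans c1 _.
  by rewrite ler_wnM2r // ltW.
(* Normalized so that [ip (A (y k)) (q k) = e k] when [A (y k)] is nonzero. *)
pose q k := (e k / `|A (y k)| ^+ 2) *: A (y k).
have m0_gt0 : 0 < `|A v| / 2 by rewrite divr_gt0 // normr_gt0; apply/eqP; exact: A0.
pose r k : R := e k / (`|A v| / 2).
have r_cvg : r k @[k --> \oo] --> (0 : R).
  by rewrite -(mul0r (`|A v| / 2)^-1); apply: cvgM => //; exact: cvg_cst.
(* The cost of replacing [z + q k] by [z]: first in the second argument of [ip], then inside [A]. *)
pose rho k := `|A z| * r k + L * r k * (B + r k).
have rho_cvg : rho k @[k --> \oo] --> (0 : R).
  rewrite -[0]addr0; apply: cvgD.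
    by rewrite -(mulr0 `|A z|); apply: cvgM => //; exact: cvg_cst.
  rewrite -(mul0r (B + 0)); apply: cvgM.
    by rewrite -(mulr0 L); apply: cvgM => //; exact: cvg_cst.
  by apply: cvgD => //; exact: cvg_cst.
have key : \forall k \near \oo, - rho k <= ip (A z) (z - y k).
  have lsc : ((`|A v| / 2)%:E < limn_einf (fun k => (`|A (y k)|)%:E))%E.
    by apply: lt_le_trans Alsc; rewrite lte_fin; lra.
  have := limn_einf_ge_near lsc; apply: filterS => k; rewrite lee_fin => Ayk_ge.
  have Ayk_gt0 : 0 < `|A (y k)| by exact: lt_le_trans Ayk_ge.
  have q_norm : `|q k| <= r k.
    rewrite normrZ ger0_norm ?divr_ge0 ?(ltW (e_gt0 k)) ?sqr_ge0 //.
    rewrite expr2 invfM mulrA mulfVK ?gt_eqF // /r.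
    by rewrite ler_wpM2l ?(ltW (e_gt0 k)) // lef_pV2.
  have pos : 0 < ip (A (y k)) (z + q k - y k).
    rewrite addrAC ipDr ipZr h_ip divfK ?gt_eqF ?exprn_gt0 //.
    have := Ay_ge k; rewrite /e; have : 0 < harmonic k :> R by rewrite invr_gt0.
    have -> : - ((1 + mu) * (B * `|w k - y k|)) / c0 =
      - ((1 + mu) / c0 * B * `|w k - y k|) by field; rewrite gt_eqF.
    lra.
  have := Aqm _ _ pos.
  have h1 := ip_le h_ip (A (z + q k) - A z) (z + q k - y k).
  have h2 : `|A (z + q k) - A z| * `|z + q k - y k| <= L * r k * (B + r k).
    rewrite ler_pM //.
      by apply: le_trans (AL _ _) _; rewrite addrC addKr ler_pM2l.
    by rewrite addrAC; apply: le_trans (ler_normD _ _) _; rewrite lerD.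
  have h3 : `|A z| * `|q k| <= `|A z| * r k by rewrite ler_wpM2l.
  have h4 := ip_le h_ip (A z) (q k).
  have -> : ip (A (z + q k)) (z + q k - y k) =
      ip (A z) (z - y k) + ip (A z) (q k) + ip (A (z + q k) - A z) (z + q k - y k).
    by rewrite !ipE; ring.
  by rewrite /rho; lra.
have Az_cvg : ip (A z) (z - y k) @[k --> \oo] --> ip (A z) (z - v).
  have -> : (fun k => ip (A z) (z - y k)) = (fun k => ip (A z) z - ip (y k) (A z)).
    by apply/funext => k; rewrite ipDr ipNr (ipC _ (A z) (y k)).
  by rewrite ipDr ipNr (ipC _ (A z) v); apply: cvgB; [exact: cvg_cst | exact: yv].
rewrite -oppr0; exact: (ler_cvg_to (cvgN rho_cvg) Az_cvg key).
Qed.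

(** For two weak cluster points [p], [q] in [S], the difference of [|x n - p|^2] and [|x n - q|^2]
    shows that [ip (x n) (q - p)] converges. Its limit is both [ip p (q - p)] and [ip q (q - p)], so
    [q = p]. *)
Lemma opial (x : nat -> H) (S : set H) (M : R) :
  (forall n, `|x n| <= M) ->
  (forall p, S p -> cvgn (fun n => `|x n - p| ^+ 2)) ->
  (forall (s : nat -> nat) p, (forall n, (s n < s n.+1)%N) ->
     weak_cvg ip (x \o s) p -> S p) ->
  exists2 p, S p & weak_cvg ip x p.
Proof.
move=> xM x_cvg x_cluster.
have [s [p [sS xsp]]] := bounded_weak_subsequence h_ip xM.
have Sp := x_cluster _ _ sS xsp.
exists p => // v; apply: contrapT => /cvgrPdist_lt/existsNP[e /not_implyP[e_gt0 far]].
(* If weak convergence fails at [v], some subsequence stays [e] away from the limit; a weak cluster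
   point of it yields the second point [q]. *)
have /choice[g g_far] (N : nat) : exists n, (N <= n)%N /\ ~ `|ip p v - ip (x n) v| < e.
  apply: contrapT => h; apply: far; exists N => // n /= Nn.
  by apply: contrapT => nlt; apply: h; exists n.
pose t := fix t j := if j is j'.+1 then g (t j').+1 else g 0%N.
have tS j : (t j < t j.+1)%N by exact: (g_far (t j).+1).1.
have t_far j : ~ `|ip p v - ip (x (t j)) v| < e.
  by case: j => [|j] /=; exact: (g_far _).2.
have [s' [q [s'S xq]]] := bounded_weak_subsequence h_ip (fun n => xM (t n)).
have t_mono := homo_ltn ltn_trans tS.
have tsS n : (t (s' n) < t (s' n.+1))%N by exact: t_mono.
have Sq : S q by exact: (x_cluster (t \o s')).
have [lp lpE] : exists lp : R, `|x n - p| ^+ 2 @[n --> \oo] --> lp.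
  by apply/cvg_ex; exact: x_cvg.
have [lq lqE] : exists lq : R, `|x n - q| ^+ 2 @[n --> \oo] --> lq.
  by apply/cvg_ex; exact: x_cvg.
have ip_lim : ip (x n) (q - p) @[n --> \oo] -->
    (lp - lq - `|p| ^+ 2 + `|q| ^+ 2) / 2.
  have -> : (fun n => ip (x n) (q - p)) =
      (fun n => (`|x n - p| ^+ 2 - `|x n - q| ^+ 2 - `|p| ^+ 2 + `|q| ^+ 2) / 2).
    by apply/funext => n; rewrite -!h_ip !ipE (ipC _ p (x n)) (ipC _ q (x n)); field.
  apply: cvgM; last exact: cvg_cst.
  apply: cvgD; last exact: cvg_cst.
  by apply: cvgB; [exact: cvgB | exact: cvg_cst].
have Rhaus : hausdorff_space R^o by exact: norm_hausdorff.
have p_lim := cvg_unique Rhaus (xsp (q - p)) (cvg_comp _ _ (cvgn_extract sS) ip_lim).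
have q_lim := cvg_unique Rhaus (xq (q - p))
  (cvg_comp _ _ (@cvgn_extract (t \o s') tsS) ip_lim).
have qp : q = p.
  apply/eqP; rewrite -subr_eq0 -normr_eq0 -sqrf_eq0 -h_ip ipDl ipNl.
  by rewrite p_lim q_lim subrr.
have := xq v; rewrite qp => /cvgrPdist_lt /(_ e e_gt0)[n _ /(_ n (leqnn n))].
exact: t_far.
Qed.

End WeakLimits.

(** * Weak convergence of the algorithm *)

Theorem theorem4p1 (R : realType) (H : completeNormedModType R)
  (ip : {dot H for idfun}) (h_ip : induces_norm ip)
  (C : set H) (hC0 : C !=set0) (hC_closed : closed C) (hC_convex : convex_set C)
  (A : H -> H)
  (h_i : dual_VI_solutions ip A C !=set0)
  (h_ii : lipschitz A)
  (h_iii : forall (u : nat -> H) (v : H), (forall k, C (u k)) ->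
     weak_cvg ip u v ->
     ((`|A v|)%:E <= limn_einf (fun k => (`|A (u k)|)%:E))%E)
  (h_iv : quasimonotone ip A)
  (h_v : finite_set ([set v | C v /\ A v = 0] `\` dual_VI_solutions ip A C))
  (mu alpha beta : R) (h_mu : 0 < mu < 1)
  (h_a : 0 <= alpha <= (1 - mu) / (3 + mu))
  (h_b : Num.max (2 * alpha * ((1 - mu) / (3 + mu)) - (1 - alpha))
           (1 / 2 * (alpha * (1 + mu)
                     - (1 - mu) * (1 - alpha) ^+ 2 / (1 + alpha)))
         < beta <= 0)
  (h_c : 2 * alpha ^+ 2 * mu - (1 - 3 * alpha) + mu * (1 - alpha)
         - beta * (4 * alpha + 3 - mu) + 2 * mu * beta ^+ 2 < 0)
  (h_A : forall x, C x -> A x <> 0)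
  (gamma l lambda0 : R) (h_gamma : 0 < gamma) (h_l : 0 < l < 1)
  (h_lambda0 : 0 < lambda0)
  (x : nat -> H)
  (h_x : two_step_inertial_tseng A C gamma l mu lambda0 alpha beta x) :
  (exists2 p, dual_VI_solutions ip A C p & weak_cvg ip x p) /\
  dual_VI_solutions ip A C `<=` VI_solutions ip A C.
Proof.
have /andP[mu_gt0 mu_lt1] := h_mu.
have [alpha_ge0 alpha_lt1] : 0 <= alpha /\ alpha < 1.
  case/andP: h_a => a_ge0 a_le; split=> //; apply: le_lt_trans a_le _.
  by rewrite ltr_pdivrMr; lra.
have [beta_gt beta_le0] : alpha - 1 < beta /\ beta <= 0.
  case/andP: h_b => b_gt b_le0; split=> //; apply: le_lt_trans b_gt.
  rewrite le_max; apply/orP; left.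
  suff : 0 <= 2 * alpha * ((1 - mu) / (3 + mu)) by lra.
  by rewrite !mulr_ge0 ?invr_ge0 //; lra.
have [L L_gt0 AL] := lipschitz_norm h_ii.
have dual_sub := dual_VI_subset h_ip hC_convex AL.
split=> //.
case: h_x => w0 [y0 [lam0 [m0 [lam00 alg]]]].
(* With this shift, [w n] is built from [x n], [x n.+1], [x n.+2] and produces [x n.+3]. *)
pose w n := w0 n.+1; pose y n := y0 n.+1; pose lam n := lam0 n.+1.
have l_gt0 : 0 < l by case/andP: h_l.
pose c0 := Num.min lambda0 (Num.min gamma (l * mu / L)).
have c0_gt0 : 0 < c0 by rewrite !lt_min h_lambda0 h_gamma !mulr_gt0 ?invr_gt0.
have lam0_ge k : c0 <= lam0 k.
  elim: k => [|k IH]; first by rewrite lam00 ge_min lexx.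
  have [_ _ [ls ->] _ _] := alg k.+1 isT.
  apply: (stepsize_lower_bound h_gamma h_l mu_gt0 AL L_gt0 IH _ _ ls).
    by rewrite !ge_min lexx orbT.
  by rewrite -ler_pdivlMr // !ge_min lexx !orbT.
have lam_ge k : c0 <= lam k by exact: lam0_ge.
have lam_ge0 k : 0 <= lam k by exact: le_trans (ltW c0_gt0) _.
have hlam k : lam k * `|A (w k) - A (y k)| <= mu * `|w k - y k|.
  have [_ _ [ls lamE] _ _] := alg k.+1 isT.
  by rewrite /lam lamE; exact: (stepsize_control _ ls).
have wE n : w n = x n.+2 + alpha *: (x n.+2 - x n.+1) + beta *: (x n.+1 - x n).
  by have [] := alg n.+1 isT.
have proj_y n : is_metric_projection C (w n - lam n *: A (w n)) (y n).
  by have [] := alg n.+1 isT.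
have xE n : x n.+3 = y n - lam n *: (A (y n) - A (w n)).
  by have [] := alg n.+1 isT.
have fejer p (Sp : dual_VI_solutions ip A C p) :=
  inertial_fejer h_ip mu_gt0 mu_lt1 alpha_ge0 beta_gt beta_le0 h_c wE
    (fun n => tseng_step h_ip hC_convex h_mu (lam_ge0 n) (hlam n) (proj_y n) Sp (xE n)).
have [p0 Sp0] := h_i.
have [[M xM] dx0 _] := fejer p0 Sp0.
pose dx n : R := `|x n.+1 - x n|; pose s n : R := dx n.+2 + dx n.+1 + dx n.
have dx_ge0 n : 0 <= dx n by exact: normr_ge0.
have s_cvg : s n @[n --> \oo] --> (0 : R).
  have dx1 : dx n.+1 @[n --> \oo] --> (0 : R) by rewrite (cvg_shiftS dx).
  have dx2 : dx n.+2 @[n --> \oo] --> (0 : R).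
    by rewrite (cvg_shiftS (fun n => dx n.+1)).
  by rewrite -[0]addr0; apply: cvgD dx0; rewrite -[0]addr0; exact: cvgD.
have wx n : `|w n - x n.+2| <= dx n.+1 + dx n.
  rewrite wE -(addrA (x n.+2)) addrAC subrr add0r; apply: le_trans (ler_normD _ _) _.
  rewrite !normrZ (ger0_norm alpha_ge0) (ler0_norm beta_le0) lerD // ler_piMl //; lra.
(* The correction step moves [y n] by at most [mu * |w n - y n|], so [(1 - mu) * |w n - y n|] is at
   most [|w n - x n.+3|]. *)
have wy n : `|w n - y n| <= s n / (1 - mu).
  rewrite ler_pdivlMr; last by lra.
  have h1 : `|w n - y n| <= `|w n - x n.+3| + `|x n.+3 - y n|.
    exact: ler_distD.
  have h2 : `|x n.+3 - y n| <= mu * `|w n - y n|.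
    rewrite xE addrAC subrr add0r normrN normrZ ger0_norm // distrC; exact: hlam.
  have h3 : `|w n - x n.+3| <= `|w n - x n.+2| + dx n.+2.
    by rewrite /dx (distrC (x n.+3)); exact: ler_distD.
  by have := wx n; rewrite /s; lra.
pose kappa : R := (1 - mu)^-1 + 2.
have s_ge0 n : 0 <= s n by rewrite !addr_ge0.
(* Comparing [y n] with [x n], rather than with the nearer [x n.+2], lets one extraction [t] serve
   both sequences. *)
have yx n : `|y n - x n| <= kappa * s n.
  have h1 : `|y n - x n| <= `|w n - y n| + `|w n - x n|.
    by rewrite (distrC (w n)); exact: ler_distD.
  have h2 : `|w n - x n| <= `|w n - x n.+2| + `|x n.+2 - x n| by exact: ler_distD.
  have h3 : `|x n.+2 - x n| <= dx n.+1 + dx n by exact: ler_distD.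
  have := wy n; have := wx n; have := dx_ge0 n.+2.
  by rewrite /kappa mulrDl (mulrC _ (s n)) /s; lra.
have yx0 : `|y n - x n| @[n --> \oo] --> (0 : R).
  apply: (@cvgn_dist_le _ R^o _ _ (fun n => kappa * s n)).
    by apply: nearW => n; rewrite subr0 normr_id.
  by rewrite -(mulr0 kappa); apply: cvgM => //; exact: cvg_cst.
have wy0 : `|w n - y n| @[n --> \oo] --> (0 : R).
  apply: (@cvgn_dist_le _ R^o _ _ (fun n => s n / (1 - mu))).
    by apply: nearW => n; rewrite subr0 normr_id.
  by rewrite -(mul0r (1 - mu)^-1); apply: cvgM => //; exact: cvg_cst.
have yM n : `|y n| <= kappa * (6 * M) + M.
  rewrite -[y n](subrK (x n)); apply: le_trans (ler_normD _ _) _.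
  rewrite lerD //; apply: le_trans (yx n) _; rewrite ler_wpM2l //.
    by rewrite addr_ge0 ?invr_ge0 //; lra.
  have dxM k : dx k <= 2 * M.
    by apply: le_trans (ler_normB _ _) _; have := xM k; have := xM k.+1; lra.
  by have := dxM n; have := dxM n.+1; have := dxM n.+2; rewrite /s; lra.
apply: (opial h_ip xM) => [p Sp|t v tS xv]; first by have [] := fejer p Sp.
have tinfty := cvgn_extract tS.
have yv : weak_cvg ip (y \o t) v.
  by apply: weak_cvg_dist0 xv _ => //; exact: cvg_comp tinfty yx0.
apply: (weak_limit_dual_VI (w := w \o t) (y := y \o t) (lam := lam \o t)
  h_ip hC_closed hC_convex L_gt0 AL h_iv h_A _ h_mu c0_gt0) => //=.
- by apply: h_iii yv => k; exact: (proj_y _).1.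
- exact: cvg_comp tinfty wy0.
Qed.
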